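(* Let $c>0$, $\beta\in[0,1)$, $a>0$ and $n\in\mathbb{N}$ with $n>3c$. Let $f\in C_{\rho_0}(\mathbb{R}^+)$, with $M_f$ a constant such that $|f(x)|\le M_f(1+x^2)$ for all $x\ge0$, and let $\omega_{a+1}(f,\delta)$ be its modulus of continuity on $[0,a+1]$. Then for every $x\in[0,a]$, $$|\mathcal{D}_{n,c}^{\beta}(f,x)-f(x)|\le 6M_f(1+a^2)\,\mu_{2,n,c}^{\beta}(x)+2\,\omega_{a+1}\Big(f,\sqrt{\mu_{2,n,c}^{\beta}(x)}\Big).$$
   Context: For $\beta\in[0,1)$, $x\ge 0$, $n\in\mathbb{N}$ and integers $v\ge0$ let $\omega_\beta(v,nx)=nx(nx+v\beta)^{v-1}\frac{e^{-(nx+v\beta)}}{v!}$. For $c>0$, integers $v\ge1$ and $t\ge0$ let $p_{n,v-1,c}(t)=c\,\frac{\Gamma(n/c+v-1)}{\Gamma(v)\Gamma(n/c)}\cdot\frac{(ct)^{v-1}}{(1+ct)^{n/c+v-1}}$. The modified Jain-Baskakov operators are $$\mathcal{D}_{n,c}^{\beta}(f,x)=\frac{n-c}{c}\sum_{v=1}^{\infty}\omega_\beta(v,nx)\int_0^\infty p_{n,v-1,c}(t)f(t)\,dt+e^{-nx}f(0).$$ $\mu_{2,n,c}^{\beta}(x)=\mathcal{D}_{n,c}^{\beta}((t-x)^2,x)$, the operator applied to $t\mapsto(t-x)^2$ evaluated at $x$. With $\rho_0(x)=1+x^2$, $B_{\rho_0}(\mathbb{R}^+)$ is the set of functions $f$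 on $[0,\infty)$ with $|f(x)|\le M_f(1+x^2)$ for some constant $M_f$, and $C_{\rho_0}(\mathbb{R}^+)$ is the set of continuous $f\in B_{\rho_0}(\mathbb{R}^+)$ such that $f(x)/\rho_0(x)$ converges as $x\to\infty$. $\omega_{a+1}(f,\delta)=\sup\{|f(t)-f(x)|: x,t\in[0,a+1],\ |t-x|\le\delta\}$. *)

(* Defs.v *)
From Stdlib Require Import Reals Arith Factorial.
From Coquelicot Require Import Coquelicot.
Open Scope R_scope.

Definition Gamma (s : R) : R :=
  RInt_gen (fun t => Rpower t (s - 1) * exp (- t)) (at_right 0) (Rbar_locally p_infty).

Definition omega_beta (beta : R) (v : nat) (y : R) : R :=
  y * (y + INR v * beta) ^ (v - 1) * exp (- (y + INR v * beta)) / INR (Factorial.fact v).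

Definition p_nvc (n : nat) (v : nat) (c t : R) : R :=
  c * (Gamma (INR n / c + INR v - 1) / (Gamma (INR v) * Gamma (INR n / c)))
    * ((c * t) ^ (v - 1) / Rpower (1 + c * t) (INR n / c + INR v - 1)).

Definition D_op (n : nat) (c beta : R) (f : R -> R) (x : R) : R :=
  (INR n - c) / c *
    Series (fun k : nat =>
      let v := S k in
      omega_beta beta v (INR n * x) *
      RInt_gen (fun t => p_nvc n v c t * f t) (at_point 0) (Rbar_locally p_infty))
  + exp (- (INR n * x)) * f 0.

Definition mu2 (n : nat) (c beta x : R) : R :=
  D_op n c beta (fun t => (t - x) ^ 2) x.

Definition C_rho0 (f : R -> R) : Prop :=
  (forall x, 0 <= x ->
     filterlim f (within (fun y => 0 <= y) (locally x)) (locally (f x))) /\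
  (exists M, forall x, 0 <= x -> Rabs (f x) <= M * (1 + x ^ 2)) /\
  (exists L, filterlim (fun x => f x / (1 + x ^ 2)) (Rbar_locally p_infty) (locally L)).

Definition modcont (a : R) (f : R -> R) (delta : R) : R :=
  real (Lub_Rbar (fun y => exists x t, 0 <= x <= a + 1 /\ 0 <= t <= a + 1 /\
                      Rabs (t - x) <= delta /\ y = Rabs (f t - f x))).

(* Main.v *)
Require Import Defs.
From Stdlib Require Import Reals.
From Coquelicot Require Import Coquelicot.
From Stdlib Require Import Lra Lia Factorial.
Open Scope R_scope.

(** The operator is the expectation of [f T] for a random [T >= 0]: the Jain weights
    together with [exp (- n x)] sum to [1], and so does each normalised Baskakov density.
    For [delta > 0] and [t >= 0],
    [|f t - f x| <= 6 Mf (1 + a^2) (t - x)^2 + (1 + (t - x)^2 / delta^2) omega(delta)],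
    the first term accounting for [t > a + 1] and the second for [t <= a + 1].
    Taking expectations with [delta^2 = mu2] gives the estimate, without Cauchy-Schwarz.
    That the Jain weights have total mass [1] comes from the difference-differential
    equation [F' y = F (y + beta) - F y] satisfied by their sum [F]: a solution of small
    exponential growth is constant because [beta < 1]. *)

(** * The Jain distribution *)

(** The majorant combines only [(t - x) ^ 2] and [1], so each Baskakov density enters through its
    mass and its mean square deviation from [x]; both are Beta integrals, and the second one
    converges because [n / c > 3]. The operator is linear in these two quantities, so their
    expectations are exactly [mu2] and [1], with no closed form of [mu2] required.

    [RInt_gen], [Series] and [real] are total functions with junk values, so the equalities and
    bounds rest on convergence: the integrals of [f] converge by domination by the same quadratic
    majorant, the series because Jain weights decay geometrically while the second moments grow
    quadratically.

    The total mass of the Jain weights is the delicate point, an identity of Lagrange inversion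
    type. Arguing on finite partial sums keeps differentiation elementary, at the price of one extra
    term that decays geometrically.

    The choice [delta = sqrt mu2] must be positive, which fails exactly at [x = 0]; there the
    operator is evaluation at [0]. *)

Lemma exp_le_compat (x y : R) : x <= y -> exp x <= exp y.
Proof. intros [H | ->]; [left; now apply exp_increasing|apply Rle_refl]. Qed.

Lemma pow_div_fact_le_exp (x : R) (n : nat) : 0 <= x -> x ^ n / INR (fact n) <= exp x.
Proof.
  intros Hx. apply Rle_trans with (2 := exp_ge_taylor x n Hx).
  destruct n as [|n]; [apply Rle_refl|]. rewrite tech5.
  assert (0 <= sum_f_R0 (fun k => x ^ k / INR (fact k)) n); [|lra].
  apply cond_pos_sum. intros k. apply Rmult_le_pos; [now apply pow_le|].
  left; apply Rinv_0_lt_compat, INR_fact_lt_0.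
Qed.

(* [omega_beta beta 0 y] is [y * exp (- y)] because [0 - 1 = 0] in [nat];
   the term of index [0] of the distribution is [exp (- y)]. *)
Definition jain (beta : R) (v : nat) (y : R) : R :=
  match v with O => exp (- y) | S _ => omega_beta beta v y end.

Lemma jain_nonneg (beta : R) (v : nat) (y : R) : 0 <= beta -> 0 <= y -> 0 <= jain beta v y.
Proof.
  intros Hb Hy. destruct v as [|v]; unfold jain; [left; apply exp_pos|].
  unfold omega_beta. assert (0 <= INR (S v) * beta) by (apply Rmult_le_pos; [apply pos_INR|lra]).
  apply Rmult_le_pos; [|left; apply Rinv_0_lt_compat, INR_fact_lt_0].
  apply Rmult_le_pos; [|left; apply exp_pos].
  apply Rmult_le_pos; [lra|]. apply pow_le; lra.
Qed.

Lemma jain_0 (beta : R) (v : nat) : jain beta v 0 = match v with O => 1 | S _ => 0 end.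
Proof.
  destruct v; unfold jain, omega_beta; [rewrite Ropp_0; apply exp_0|]. unfold Rdiv; ring.
Qed.

(* With [l = 1 + eps] and [z = y + v * beta], [(l z) ^ v / v! <= exp (l z)] gives
   [z ^ v * exp (- z) / v! <= exp (eps * z) / l ^ v]; the choice [l = 2 / (1 + beta)]
   makes the ratio [r = exp (eps * beta) / l] smaller than [1]. *)
Lemma jain_geometric_bound (beta : R) : 0 <= beta < 1 ->
  exists eps r, 0 < r < 1 /\ 0 <= eps /\ beta * exp (eps * beta) < 1 /\
    forall v y, 0 <= y -> jain beta v y <= exp (eps * y) * r ^ v.
Proof.
  intros Hb. set (l := 2 / (1 + beta)).
  assert (Hl : 1 < l). { apply (Rmult_lt_reg_r (1 + beta)); [lra|]. unfold l; field_simplify; lra. }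
  assert (Hu : exp ((l - 1) * beta) < l).
  { set (u := (l - 1) * beta).
    (* From [exp (- u) >= 1 - u > / l] one gets [exp u < l]. For this [l] the gap [1 - u - / l] is a
       square over a positive number. *)
    assert (Hu1 : / l < 1 - u).
    { replace (1 - u - / l) with (1 - u - / l) by ring.
      apply Rminus_lt_0.
      replace (1 - u - / l) with ((1 - beta) * (1 - beta) / (2 * (1 + beta)))
        by (unfold u, l; field; lra).
      apply Rdiv_lt_0_compat; nra. }
    assert (0 < / l) by (apply Rinv_0_lt_compat; lra).
    pose proof (exp_ineq1_le (- u)) as H1. rewrite exp_Ropp in H1.
    pose proof (exp_pos u).
    apply Rinv_lt_cancel; lra. }
  exists (l - 1), (exp ((l - 1) * beta) / l).
  pose proof (exp_pos ((l - 1) * beta)) as He.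
  split; [split|split; [lra|split]].
  - apply Rdiv_lt_0_compat; lra.
  - apply (Rmult_lt_reg_r l); [lra|]. field_simplify; lra.
  - apply Rle_lt_trans with (beta * l); [apply Rmult_le_compat_l; lra|].
    replace (beta * l) with (2 * beta / (1 + beta)) by (unfold l; field; lra).
    apply (Rmult_lt_reg_r (1 + beta)); [lra|]. field_simplify; lra.
  - intros v y Hy.
    set (z := y + INR v * beta).
    assert (Hz : y <= z).
    { unfold z. assert (0 <= INR v * beta) by (apply Rmult_le_pos; [apply pos_INR|lra]). lra. }
    apply Rle_trans with (z ^ v / INR (fact v) * exp (- z)).
    { destruct v as [|v]; unfold jain.
      - unfold z; simpl. replace (y + 0 * beta) with y by ring. lra.
      - unfold omega_beta; fold z. simpl (S v - 1)%nat. rewrite Nat.sub_0_r.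
        unfold Rdiv. rewrite (Rmult_assoc (z ^ S v)), (Rmult_comm (/ _) (exp _)), <- (Rmult_assoc (z ^ S v)).
        apply Rmult_le_compat_r; [left; apply Rinv_0_lt_compat, INR_fact_lt_0|].
        apply Rmult_le_compat_r; [left; apply exp_pos|]. simpl.
        apply Rmult_le_compat_r; [apply pow_le|]; lra. }
    pose proof (pow_div_fact_le_exp (l * z) v) as H1.
    specialize (H1 ltac:(nra)). rewrite Rpow_mult_distr in H1.
    assert (Hlv : 0 < l ^ v) by (apply pow_lt; lra).
    replace (exp ((l - 1) * y) * (exp ((l - 1) * beta) / l) ^ v)
      with (exp (l * z) / l ^ v * exp (- z)).
    + apply Rmult_le_compat_r; [left; apply exp_pos|].
      apply (Rmult_le_reg_l (l ^ v)); [lra|].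
      replace (l ^ v * (exp (l * z) / l ^ v)) with (exp (l * z)) by (field; lra).
      replace (l ^ v * (z ^ v / INR (fact v))) with (l ^ v * z ^ v / INR (fact v))
        by (unfold Rdiv; ring). exact H1.
    + unfold Rdiv at 2. rewrite Rpow_mult_distr, pow_inv, <- (Rpower_pow v (exp _)) by apply exp_pos.
      unfold Rpower; rewrite ln_exp.
      unfold Rdiv. rewrite (Rmult_assoc (exp (l * z))), (Rmult_comm (/ _) (exp _)).
      rewrite <- (Rmult_assoc (exp (l * z))), <- (Rmult_assoc (exp ((l - 1) * y))), <- !exp_plus.
      f_equal. f_equal. unfold z. ring.
Qed.

(** Lowering the index by one while translating [y] by [beta] leaves [y + v * beta] unchanged, so
    all terms share one base [z] and one exponential, and the identity reduces to algebra. Index [0]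
    is a bare exponential and needs its own case. *)
Lemma is_derive_jain (beta : R) (v : nat) (y : R) :
  is_derive (jain beta (S v)) y (jain beta v (y + beta) - jain beta (S v) y).
Proof.
  assert (Hf : INR (fact v) <> 0) by apply INR_fact_neq_0.
  assert (Hv : INR (S v) <> 0) by (apply not_0_INR; lia).
  unfold jain, omega_beta.
  replace (fact (S v)) with (S v * fact v)%nat by reflexivity.
  rewrite mult_INR. set (w := INR (S v)) in *. set (p := INR (fact v)) in *.
  auto_derive; [trivial|].
  simpl (S v - 1)%nat. rewrite Nat.sub_0_r.
  destruct v as [|v].
  - unfold w, p; simpl. replace (y + 1 * beta) with (y + beta) by ring. field.
  - subst w p. simpl (S v - 1)%nat. rewrite Nat.sub_0_r. simpl (pred (S v)).
    replace (y + beta + INR (S v) * beta) with (y + INR (S (S v)) * beta)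
      by (rewrite (S_INR (S v)); ring).
    set (z := y + INR (S (S v)) * beta).
    replace (y + beta) with (z - INR (S v) * beta) by (unfold z; rewrite (S_INR (S v)); ring).
    replace (z ^ S v) with (z * z ^ v) by reflexivity.
    replace y with (z - INR (S (S v)) * beta) by (unfold z; ring).
    rewrite (S_INR (S v)) in *. field. tauto.
Qed.

Definition jain_sum (beta : R) (N : nat) (y : R) : R :=
  sum_f_R0 (fun v => jain beta v y) N.

(** The translated terms add up to the translated partial sum of order [N - 1]; completing it to
    order [N] costs the last term. *)
Lemma is_derive_jain_sum (beta : R) (N : nat) (y : R) :
  is_derive (jain_sum beta N) y
    (jain_sum beta N (y + beta) - jain_sum beta N y - jain beta N (y + beta)).
Proof.
  induction N as [|N IH].
  - unfold jain_sum; simpl. auto_derive; [trivial|]. ring.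
  - apply (is_derive_ext (fun z => plus (jain_sum beta N z) (jain beta (S N) z))); [reflexivity|].
    replace (jain_sum beta (S N) (y + beta) - jain_sum beta (S N) y - jain beta (S N) (y + beta))
      with (plus (jain_sum beta N (y + beta) - jain_sum beta N y - jain beta N (y + beta))
              (jain beta N (y + beta) - jain beta (S N) y))
      by (unfold plus, jain_sum; simpl; ring).
    apply @is_derive_plus; [exact IH|apply is_derive_jain].
Qed.

Lemma jain_sum_0 (beta : R) (N : nat) : jain_sum beta N 0 = 1.
Proof.
  unfold jain_sum. induction N as [|N IH].
  - exact (jain_0 beta 0).
  - rewrite tech5, IH, jain_0. ring.
Qed.

Lemma geom_sum_le (r : R) (N : nat) : 0 < r < 1 -> sum_f_R0 (fun v => r ^ v) N <= / (1 - r).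
Proof.
  intros Hr. rewrite tech3 by lra. unfold Rdiv.
  rewrite <- (Rmult_1_l (/ (1 - r))) at 2.
  apply Rmult_le_compat_r; [left; apply Rinv_0_lt_compat; lra|].
  assert (0 < r ^ S N) by (apply pow_lt; lra). lra.
Qed.

(* The partial sums satisfy [F' y = F (y + beta) - F y - (last term)] and
   [F (y + beta) - F y = beta * F' xi], so an exponential bound on [F'] improves
   by the factor [beta * exp (eps * beta) < 1] until only the last term is left. *)
Lemma is_series_omega_beta (beta y : R) : 0 <= beta < 1 -> 0 <= y ->
  is_series (fun k => omega_beta beta (S k) y) (1 - exp (- y)).
Proof.
  intros Hb Hy.
  destruct (jain_geometric_bound beta Hb) as (eps & r & Hr & Heps & Hq & Hbd).
  set (E := exp (eps * beta)). set (q := beta * E). fold E q in Hq.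
  assert (HE : 0 < E) by apply exp_pos.
  assert (Hq0 : 0 <= q) by (unfold q; apply Rmult_le_pos; lra).
  set (dF N z := jain_sum beta N (z + beta) - jain_sum beta N z - jain beta N (z + beta)).
  set (G := / (1 - r)).
  assert (HG : 0 < G) by (apply Rinv_0_lt_compat; lra).
  assert (HF : forall N z, 0 <= z -> 0 <= jain_sum beta N z <= exp (eps * z) * G).
  { intros N z Hz. unfold jain_sum. split.
    - apply cond_pos_sum. intros v; apply jain_nonneg; lra.
    - apply Rle_trans with (sum_f_R0 (fun v => r ^ v * exp (eps * z)) N).
      + apply sum_Rle. intros v _. rewrite Rmult_comm. now apply Hbd.
      + rewrite <- scal_sum. apply Rmult_le_compat_l; [left; apply exp_pos|].
        now apply geom_sum_le. }
  assert (HJ : forall N z, 0 <= z -> 0 <= jain beta N (z + beta) <= exp (eps * z) * E * r ^ N).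
  { intros N z Hz. split; [apply jain_nonneg; lra|].
    unfold E. rewrite <- exp_plus, <- Rmult_plus_distr_l. apply Hbd; lra. }
  (* [C] is the fixed point of [C = q * C + E]: each improvement multiplies the accumulated error by
     [q] and adds a last term of size at most [E * r ^ N]. *)
  set (C := E / (1 - q)).
  assert (HC : q * C + E = C) by (unfold C; field; lra).
  (* [j] counts the uses of the mean value theorem. At [j = 0] the bounds [E * G], [G] and [E] of
     the three terms of [dF] are added. *)
  assert (HdF : forall N j z, 0 <= z ->
     Rabs (dF N z) <= exp (eps * z) * ((E * G + G + E) * q ^ j + C * r ^ N)).
  { intros N j.
    assert (Hrp : 0 < r ^ N <= 1).
    { split; [apply pow_lt; lra|]. rewrite <- (pow1 N). apply pow_incr; lra. }
    assert (HC0 : 0 < C) by (apply Rdiv_lt_0_compat; lra).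
    induction j as [|j IH]; intros z Hz.
    - pose proof (exp_pos (eps * z)) as Hp.
      pose proof (HF N z Hz) as H1. pose proof (HF N (z + beta) ltac:(lra)) as H2.
      rewrite Rmult_plus_distr_l, exp_plus in H2. fold E in H2.
      pose proof (HJ N z Hz) as H3.
      apply Rle_trans with (exp (eps * z) * (E * G + G + E)).
      + assert (exp (eps * z) * E * r ^ N <= exp (eps * z) * E) by nra.
        unfold dF. apply Rabs_le. split; nra.
      + apply Rmult_le_compat_l; [lra|]. simpl.
        assert (0 < C * r ^ N) by (apply Rmult_lt_0_compat; lra). lra.
    - destruct (MVT_gen (jain_sum beta N) z (z + beta) (dF N)) as (xi & Hxi & Heq).
      + intros w _. apply is_derive_jain_sum.
      + intros w _. apply derivable_continuous_pt, ex_derive_Reals_0.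
        eexists; apply is_derive_jain_sum.
      + rewrite Rmin_left, Rmax_right in Hxi by lra.
        replace (z + beta - z) with beta in Heq by ring.
        pose proof (HJ N z Hz) as H3.
        specialize (IH xi ltac:(lra)).
        set (K := (E * G + G + E) * q ^ j + C * r ^ N) in *.
        assert (HK : 0 <= K).
        { assert (0 <= q ^ j) by now apply pow_le. unfold K.
          apply Rplus_le_le_0_compat; apply Rmult_le_pos; nra. }
        (* Since [xi <= z + beta], moving the bound back to [z] costs the factor [E]; with the
           length [beta] of the interval this makes [q]. *)
        assert (Hexp : exp (eps * xi) <= exp (eps * z) * E).
        { unfold E. rewrite <- exp_plus. apply exp_le_compat. nra. }
        assert (Hd : Rabs (dF N xi * beta) <= exp (eps * z) * (q * K)).
        { rewrite Rabs_mult, (Rabs_pos_eq beta) by lra.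
          replace (exp (eps * z) * (q * K)) with (exp (eps * z) * E * K * beta) by (unfold q; ring).
          apply Rmult_le_compat_r; [lra|].
          apply Rle_trans with (1 := IH). apply Rmult_le_compat_r; lra. }
        replace (exp (eps * z) * ((E * G + G + E) * q ^ S j + C * r ^ N))
          with (exp (eps * z) * (q * K) + exp (eps * z) * E * r ^ N).
        * unfold dF. rewrite Heq. apply Rabs_le_between in Hd. apply Rabs_le; split; lra.
        * unfold K. rewrite <- HC at 2. simpl. ring. }
  assert (HdF' : forall N z, 0 <= z -> Rabs (dF N z) <= exp (eps * z) * (C * r ^ N)).
  { intros N z Hz.
    apply (is_lim_seq_le (fun _ => Rabs (dF N z))
             (fun j => exp (eps * z) * ((E * G + G + E) * q ^ j + C * r ^ N))
             (Rabs (dF N z)) (exp (eps * z) * (C * r ^ N))).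
    - intros j; now apply HdF.
    - apply is_lim_seq_const.
    - apply (is_lim_seq_scal_l _ (exp (eps * z)) (C * r ^ N)).
      replace (Finite (C * r ^ N)) with (Finite ((E * G + G + E) * 0 + C * r ^ N))
        by (f_equal; ring).
      apply is_lim_seq_plus'; [|apply is_lim_seq_const].
      apply (is_lim_seq_scal_l _ _ 0), is_lim_seq_geom. rewrite Rabs_pos_eq; lra. }
  (* Every partial sum equals [1] at [0], and its derivative on [[0, y]] is of order [r ^ N]. *)
  assert (Hlim : is_lim_seq (fun N => jain_sum beta N y) 1).
  { apply (is_lim_seq_le_le (fun N => 1 - exp (eps * y) * y * C * r ^ N) _
             (fun N => 1 + exp (eps * y) * y * C * r ^ N)).
    - intros N.
      destruct (MVT_gen (jain_sum beta N) 0 y (dF N)) as (xi & Hxi & Heq).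
      + intros w _. apply is_derive_jain_sum.
      + intros w _. apply derivable_continuous_pt, ex_derive_Reals_0.
        eexists; apply is_derive_jain_sum.
      + rewrite Rmin_left, Rmax_right in Hxi by lra.
        rewrite jain_sum_0, Rminus_0_r in Heq.
        assert (Hd : Rabs (dF N xi * y) <= exp (eps * y) * y * C * r ^ N).
        { rewrite Rabs_mult, (Rabs_pos_eq y) by lra.
          replace (exp (eps * y) * y * C * r ^ N) with (exp (eps * y) * (C * r ^ N) * y) by ring.
          apply Rmult_le_compat_r; [lra|].
          apply Rle_trans with (1 := HdF' N xi ltac:(lra)).
          apply Rmult_le_compat_r.
          - apply Rmult_le_pos; [|apply pow_le; lra].
            left; apply Rdiv_lt_0_compat; lra.
          - apply exp_le_compat. nra. }
        apply Rabs_le_between in Hd. lra.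
    - replace (Finite 1) with (Finite (1 - exp (eps * y) * y * C * 0)) by (f_equal; ring).
      apply is_lim_seq_minus'; [apply is_lim_seq_const|].
      apply (is_lim_seq_scal_l _ _ 0), is_lim_seq_geom. rewrite Rabs_pos_eq; lra.
    - replace (Finite 1) with (Finite (1 + exp (eps * y) * y * C * 0)) by (f_equal; ring).
      apply is_lim_seq_plus'; [apply is_lim_seq_const|].
      apply (is_lim_seq_scal_l _ _ 0), is_lim_seq_geom. rewrite Rabs_pos_eq; lra. }
  assert (Hs : is_series (fun v => jain beta v y) 1).
  { apply is_series_Reals. apply is_lim_seq_Reals in Hlim. exact Hlim. }
  apply (is_series_incr_1 (fun v => jain beta v y)).
  match goal with |- is_series _ ?l => replace l with 1 end; [exact Hs|].
  unfold plus; simpl; ring.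
Qed.

(** Majorant for the Jain weights multiplied by second moments of the densities. The ratio of
    consecutive terms is [r * (k + 3) / (k + 1)]. *)
Lemma ex_series_poly2_geom (r : R) : 0 < r < 1 ->
  ex_series (fun k => INR (S k) * INR (S (S k)) * r ^ k).
Proof.
  intros Hr.
  assert (Hp : forall k, 0 < INR (S k) * INR (S (S k)) * r ^ k).
  { intros k. apply Rmult_lt_0_compat; [apply Rmult_lt_0_compat|apply pow_lt; lra];
      apply lt_0_INR; lia. }
  apply ex_series_ext with (fun k => Rabs (INR (S k) * INR (S (S k)) * r ^ k)).
  { intros k. apply Rabs_pos_eq. left; apply Hp. }
  apply ex_series_DAlembert with r; [lra| |].
  - intros k. apply Rgt_not_eq, Hp.
  - apply is_lim_seq_ext with (fun k => r + r * (2 * / INR (S k))).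
    + intros k. rewrite Rabs_pos_eq.
      * rewrite !(S_INR (S _)), (S_INR k). simpl (r ^ S k).
        assert (0 < r ^ k) by (apply pow_lt; lra).
        pose proof (pos_INR k). field. repeat split; lra.
      * left; apply Rdiv_lt_0_compat; apply Hp.
    + replace (Finite r) with (Finite (r + r * (2 * 0))) by (f_equal; ring).
      apply is_lim_seq_plus'; [apply is_lim_seq_const|].
      apply (is_lim_seq_scal_l _ r (2 * 0)), (is_lim_seq_scal_l _ 2 0).
      apply (is_lim_seq_incr_1 (fun k => / INR k)).
      apply (is_lim_seq_inv _ p_infty); [apply is_lim_seq_INR|easy].
Qed.

(** * Improper integrals and the Gamma function *)

(* [D] is a set of lower integration bounds, cofinal for [Fa]: the two cases
   of interest are [at_point 0] with [a = 0] and [at_right 0] with [0 < a]. *)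
Definition lower_bounds (Fa : (R -> Prop) -> Prop) (D : R -> Prop) : Prop :=
  Fa D /\ forall a0, D a0 -> Fa (fun a => D a /\ a <= a0).

Lemma lower_bounds_at_point (x : R) : lower_bounds (at_point x) (fun a => a = x).
Proof. split; [|intros a0 ->]; unfold at_point; auto with real. Qed.

Lemma lower_bounds_at_right (x : R) : lower_bounds (at_right x) (fun a => x < a).
Proof.
  split.
  - exists (mkposreal 1 Rlt_0_1). auto.
  - intros a0 Ha0. assert (H : 0 < a0 - x) by lra.
    exists (mkposreal _ H). intros y Hy Hxy. split; [easy|].
    unfold ball in Hy; simpl in Hy; unfold AbsRing_ball, abs, minus, plus, opp in Hy; simpl in Hy.
    apply Rabs_lt_between in Hy. lra.
Qed.

Lemma filter_prod_lower_bounds (Fa : (R -> Prop) -> Prop) (D : R -> Prop) (a0 b0 : R) :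
  Filter Fa -> lower_bounds Fa D -> D a0 ->
  filter_prod Fa (Rbar_locally p_infty) (fun ab => (D (fst ab) /\ fst ab <= a0) /\ b0 < snd ab).
Proof.
  intros FFa [_ HD] Ha0.
  apply Filter_prod with (fun a => D a /\ a <= a0) (fun b => b0 < b); [auto| |auto].
  exists b0; auto.
Qed.

Lemma is_RInt_gen_primitive (Fa Fb : (R -> Prop) -> Prop) (G g : R -> R) (la lb : R) :
  Filter Fa -> Filter Fb ->
  filter_prod Fa Fb (fun ab => forall x, Rmin (fst ab) (snd ab) <= x <= Rmax (fst ab) (snd ab) ->
    is_derive G x (g x) /\ continuous g x) ->
  filterlim G Fa (locally la) -> filterlim G Fb (locally lb) ->
  is_RInt_gen g Fa Fb (lb - la).
Proof.
  intros FFa FFb Hd Ha Hb.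
  apply (filterlimi_lim_ext_loc (fun ab => minus (G (snd ab)) (G (fst ab)))).
  - apply filter_imp with (2 := Hd). intros ab H.
    apply (is_RInt_derive G g); intros x Hx; now apply H.
  - apply (filterlim_comp_2 (fun ab : R * R => G (snd ab)) (fun ab => opp (G (fst ab))) plus
             (G := locally lb) (H := locally (opp la))).
    + apply filterlim_comp with Fb; [apply filterlim_snd|exact Hb].
    + apply filterlim_comp with (locally la); [|apply (filterlim_opp la)].
      apply filterlim_comp with Fa; [apply filterlim_fst|exact Ha].
    + apply (filterlim_plus lb (opp la)).
Qed.

Lemma is_RInt_gen_Rmult_l (Fa Fb : (R -> Prop) -> Prop) (f : R -> R) (k l : R) :
  Filter Fa -> Filter Fb ->
  is_RInt_gen f Fa Fb l -> is_RInt_gen (fun t => k * f t) Fa Fb (k * l).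
Proof. intros FFa FFb H. exact (is_RInt_gen_scal f k l H). Qed.

Lemma is_RInt_gen_Rplus (Fa Fb : (R -> Prop) -> Prop) (f g : R -> R) (lf lg : R) :
  Filter Fa -> Filter Fb ->
  is_RInt_gen f Fa Fb lf -> is_RInt_gen g Fa Fb lg ->
  is_RInt_gen (fun t => f t + g t) Fa Fb (lf + lg).
Proof. intros FFa FFb Hf Hg. exact (is_RInt_gen_plus f g lf lg Hf Hg). Qed.

Lemma is_RInt_gen_eq (Fa Fb : (R -> Prop) -> Prop) (f g : R -> R) (l l' : R) :
  Filter Fa -> Filter Fb -> (forall t, f t = g t) -> l = l' ->
  is_RInt_gen f Fa Fb l -> is_RInt_gen g Fa Fb l'.
Proof.
  intros FFa FFb Hfg -> H. apply is_RInt_gen_ext with (2 := H).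
  apply filter_forall. intros ab t _. apply Hfg.
Qed.

Lemma RInt_enlarge (g : R -> R) (a a0 b0 b : R) : a <= a0 <= b0 -> b0 <= b ->
  ex_RInt g a b -> (forall x, a <= x <= b -> 0 <= g x) -> RInt g a0 b0 <= RInt g a b.
Proof.
  intros Ha Hb Hex Hg.
  assert (H1 : ex_RInt g a b0) by (apply (ex_RInt_Chasles_1 (g : R -> R_CompleteNormedModule)) with b; [lra|easy]).
  assert (H2 : ex_RInt g a a0) by (apply (ex_RInt_Chasles_1 (g : R -> R_CompleteNormedModule)) with b0; [lra|easy]).
  assert (H3 : ex_RInt g a0 b0) by (apply (ex_RInt_Chasles_2 (g : R -> R_CompleteNormedModule)) with a; [lra|easy]).
  assert (H4 : ex_RInt g b0 b) by (apply (ex_RInt_Chasles_2 (g : R -> R_CompleteNormedModule)) with a; [lra|easy]).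
  rewrite <- (RInt_Chasles g a b0 b) by easy.
  rewrite <- (RInt_Chasles g a a0 b0) by easy.
  assert (0 <= RInt g a a0) by (apply RInt_ge_0; [lra|easy|intros; apply Hg; lra]).
  assert (0 <= RInt g b0 b) by (apply RInt_ge_0; [lra|easy|intros; apply Hg; lra]).
  unfold plus; simpl; lra.
Qed.

Lemma RInt_le_RInt_gen (Fa : (R -> Prop) -> Prop) (D : R -> Prop) (h : R -> R) (a b l : R) :
  ProperFilter Fa -> lower_bounds Fa D ->
  (forall a b, D a -> a <= b -> ex_RInt h a b) ->
  (forall a x, D a -> a <= x -> 0 <= h x) ->
  is_RInt_gen h Fa (Rbar_locally p_infty) l ->
  D a -> a <= b -> RInt h a b <= l.
Proof.
  intros FFa HD Hex Hh Hl Ha Hab.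
  apply le_epsilon. intros eps Heps.
  assert (Hloc : locally l (fun y => y < l + eps)).
  { exists (mkposreal eps Heps). intros y Hy.
    unfold ball in Hy; simpl in Hy; unfold AbsRing_ball, abs, minus, plus, opp in Hy; simpl in Hy.
    apply Rabs_lt_between in Hy. lra. }
  pose proof (filter_and _ _ (filter_prod_lower_bounds Fa D a b _ HD Ha) (Hl _ Hloc)) as H.
  apply filter_ex in H. destruct H as [[a' b'] [[[Ha' Haa'] Hbb'] [y [Hy Hyl]]]]. simpl in *.
  apply (is_RInt_unique (V := R_CompleteNormedModule)) in Hy.
  apply Rle_trans with (RInt h a' b'); [|lra].
  apply RInt_enlarge; [lra|lra|apply Hex; auto; lra|].
  intros x Hx. apply (Hh a'); tauto.
Qed.

(** The limit is the supremum of the integrals over [[a, b]]: they increase with the interval, so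
    once one of them is within [eps] of the supremum, all larger intervals are too. *)
Lemma ex_RInt_gen_nonneg_bounded (Fa : (R -> Prop) -> Prop) (D : R -> Prop) (g : R -> R) (K : R) :
  ProperFilter Fa -> lower_bounds Fa D ->
  (forall a b, D a -> a <= b -> ex_RInt g a b) ->
  (forall a x, D a -> a <= x -> 0 <= g x) ->
  (forall a b, D a -> a <= b -> RInt g a b <= K) ->
  ex_RInt_gen g Fa (Rbar_locally p_infty).
Proof.
  intros FFa HD Hex Hg HK.
  set (E := fun v => exists a b, D a /\ a <= b /\ v = RInt g a b).
  destruct (completeness E) as [m [Hub Hlub]].
  - exists K. intros v (a & b & Ha & Hab & ->). auto.
  - destruct (filter_ex _ (proj1 HD)) as [a Ha].
    exists (RInt g a a), a, a. repeat split; auto with real.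
  - exists m. intros P [eps HP].
    destruct (Classical_Prop.classic (exists a b, D a /\ a <= b /\ m - eps < RInt g a b))
      as [(a & b & Ha & Hab & Hm)|Hn].
    + pose proof (filter_prod_lower_bounds Fa D a b _ HD Ha) as H.
      unfold filtermapi. apply filter_imp with (2 := H).
      intros [a' b'] [[Ha' Haa'] Hbb']. simpl in *.
      exists (RInt g a' b').
      assert (Hex' : ex_RInt g a' b') by (apply Hex; auto; lra).
      split; [now apply (RInt_correct g)|].
      apply HP. unfold ball; simpl; unfold AbsRing_ball, abs, minus, plus, opp; simpl.
      assert (RInt g a b <= RInt g a' b').
      { apply RInt_enlarge; [lra|lra|easy|]. intros x Hx; apply (Hg a'); tauto. }
      assert (RInt g a' b' <= m) by (apply Hub; exists a', b'; repeat split; auto; lra).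
      apply Rabs_lt_between. pose proof (cond_pos eps). lra.
    + exfalso. pose proof (cond_pos eps).
      assert (m <= m - eps); [|lra].
      apply Hlub. intros v (a & b & Ha & Hab & ->).
      apply Rnot_lt_le. intros H'. apply Hn. now exists a, b.
Qed.

(** The function [g + h] is nonnegative with integrals at most twice that of [h], so the monotone
    case applies to it; then [h] is subtracted. *)
Lemma ex_RInt_gen_dominated (Fa : (R -> Prop) -> Prop) (D : R -> Prop) (g h : R -> R) :
  ProperFilter Fa -> lower_bounds Fa D ->
  (forall a b, D a -> a <= b -> ex_RInt g a b) ->
  (forall a b, D a -> a <= b -> ex_RInt h a b) ->
  (forall a x, D a -> a <= x -> Rabs (g x) <= h x) ->
  ex_RInt_gen h Fa (Rbar_locally p_infty) ->
  ex_RInt_gen g Fa (Rbar_locally p_infty).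
Proof.
  intros FFa HD Hg Hh Hgh [l Hl].
  assert (Hh0 : forall a x, D a -> a <= x -> 0 <= h x).
  { intros a x Ha Hx. apply Rle_trans with (2 := Hgh a x Ha Hx), Rabs_pos. }
  destruct (ex_RInt_gen_nonneg_bounded Fa D (fun t => g t + h t) (l + l) FFa HD) as [l' Hl'].
  - intros a b Ha Hab. apply (ex_RInt_plus (V := R_NormedModule) g h); auto.
  - intros a x Ha Hx. pose proof (Hgh a x Ha Hx) as H.
    apply Rabs_le_between in H. lra.
  - intros a b Ha Hab.
    assert (Hp : RInt (fun t => g t + h t) a b = RInt g a b + RInt h a b)
      by (apply (RInt_plus (V := R_CompleteNormedModule) g h); auto).
    assert (RInt h a b <= l) by now apply (RInt_le_RInt_gen Fa D).
    assert (RInt g a b <= RInt h a b).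
    { apply RInt_le; auto. intros x Hx.
      apply Rle_trans with (1 := Rle_abs _). apply (Hgh a); [easy|lra]. }
    lra.
  - exists (minus l' l).
    apply (is_RInt_gen_ext (fun t => minus (g t + h t) (h t))).
    + apply filter_forall. intros ab x _. unfold minus, plus, opp; simpl; ring.
    + now apply (is_RInt_gen_minus (fun t => g t + h t) h).
Qed.

Lemma filter_prod_at_right_0 (P : R * R -> Prop) :
  (forall a b, 0 < a < 1 -> 1 < b -> P (a, b)) ->
  filter_prod (at_right 0) (Rbar_locally p_infty) P.
Proof.
  intros H. apply Filter_prod with (fun a => 0 < a < 1) (fun b => 1 < b); [| |auto].
  - exists (mkposreal 1 Rlt_0_1). intros y Hy H0. split; [easy|].
    unfold ball in Hy; simpl in Hy; unfold AbsRing_ball, abs, minus, plus, opp in Hy; simpl in Hy.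
    apply Rabs_lt_between in Hy. lra.
  - now exists 1.
Qed.

(** * The Gamma integral and its functional equation *)

Lemma is_derive_Rpower (p x : R) : 0 < x ->
  is_derive (fun t => Rpower t p) x (p * Rpower x (p - 1)).
Proof. intros Hx. apply is_derive_Reals. now apply derivable_pt_lim_power. Qed.

Lemma continuous_Rpower (p x : R) : 0 < x -> continuous (fun t => Rpower t p) x.
Proof. intros Hx. apply (ex_derive_continuous (fun t => Rpower t p)). eexists; now apply is_derive_Rpower. Qed.

Definition gamma_density (s t : R) : R := Rpower t (s - 1) * exp (- t).

Lemma continuous_gamma_density (s x : R) : 0 < x -> continuous (gamma_density s) x.
Proof.
  intros Hx. apply (continuous_mult (fun t => Rpower t (s - 1)) (fun t => exp (- t))).
  - now apply continuous_Rpower.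
  - apply (ex_derive_continuous (fun t => exp (- t))). auto_derive; auto.
Qed.

Lemma ex_RInt_gamma_density (s a b : R) : 0 < a -> a <= b -> ex_RInt (gamma_density s) a b.
Proof.
  intros Ha Hab. apply (ex_RInt_continuous (V := R_CompleteNormedModule) (gamma_density s)). intros z Hz.
  rewrite Rmin_left in Hz by lra. apply continuous_gamma_density; lra.
Qed.

Lemma gamma_density_pos (s t : R) : 0 < gamma_density s t.
Proof. apply Rmult_lt_0_compat; apply exp_pos. Qed.

(** For [1 <= s] the density is bounded near [0], so a single exponential dominates it on the whole
    half-line. The arguments met later are [n / c] and positive integers. *)
Lemma gamma_density_le (s : R) : 1 <= s -> exists C, 0 < C /\
  forall t, 0 < t -> gamma_density s t <= C * exp (- (t / 2)).
Proof.
  intros [Hs| <-].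
  (* [ln w <= w] at [w = t / (2 * p)] gives [p * ln t <= t / 2 + p * ln (2 * p)], which spends half
     of the exponent [- t]. *)
  - set (p := s - 1). exists (exp (p * ln (2 * p))). split; [apply exp_pos|].
    intros t Ht. unfold gamma_density, Rpower; fold p. rewrite <- !exp_plus. apply exp_le_compat.
    assert (Hp : 0 < p) by (unfold p; lra).
    assert (Hln : ln (t / (2 * p)) <= t / (2 * p)).
    { assert (H0 : 0 < t / (2 * p)) by (apply Rdiv_lt_0_compat; lra).
      pose proof (exp_ineq1_le (ln (t / (2 * p)))) as H. rewrite exp_ln in H; lra. }
    rewrite ln_div in Hln by lra.
    apply (Rmult_le_compat_l p) in Hln; [|lra].
    replace (p * (t / (2 * p))) with (t / 2) in Hln by (field; lra). lra.
  - exists 1. split; [lra|]. intros t Ht. unfold gamma_density.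
    rewrite Rminus_diag, Rpower_O by easy. rewrite !Rmult_1_l. apply exp_le_compat. lra.
Qed.

Lemma is_lim_exp_opp_half : filterlim (fun t => exp (- (t / 2))) (Rbar_locally p_infty) (locally 0).
Proof.
  apply (is_lim_comp exp (fun t => - (t / 2)) p_infty 0 m_infty).
  - apply is_lim_exp_m.
  - apply is_lim_ext with (fun t => (- / 2) * t); [intros; field|].
    replace m_infty with (Rbar_mult (- / 2) p_infty).
    + apply is_lim_scal_l, is_lim_id.
    + simpl. case Rle_dec; intros; [exfalso; lra|easy].
  - now exists 0.
Qed.

Lemma ex_RInt_gen_gamma_density (s : R) : 1 <= s ->
  ex_RInt_gen (gamma_density s) (at_right 0) (Rbar_locally p_infty).
Proof.
  intros Hs. destruct (gamma_density_le s Hs) as (C & HC & Hle).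
  apply (ex_RInt_gen_dominated (at_right 0) (fun a => 0 < a) _ (fun t => C * exp (- (t / 2)))).
  - apply at_right_proper_filter.
  - apply lower_bounds_at_right.
  - apply ex_RInt_gamma_density.
  - intros a b Ha Hab. apply (ex_RInt_continuous (V := R_CompleteNormedModule) (fun t => C * exp (- (t / 2)))). intros z _.
    apply (ex_derive_continuous (fun t => C * exp (- (t / 2)))). auto_derive; auto.
  - intros a x Ha Hx. rewrite Rabs_pos_eq by (left; apply gamma_density_pos). apply Hle; lra.
  - exists (-2 * C * 0 - -2 * C * exp (- (0 / 2))).
    apply (is_RInt_gen_primitive (at_right 0) (Rbar_locally p_infty)
             (fun t => -2 * C * exp (- (t / 2)))).
    + apply filter_filter.
    + apply filter_filter.
    + apply filter_forall. intros ab x _. split; [auto_derive; auto; unfold Rdiv; field|].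
      apply (ex_derive_continuous (fun t => C * exp (- (t / 2)))). auto_derive; auto.
    + apply (filterlim_filter_le_1 (fun t => -2 * C * exp (- (t / 2))) (F := locally 0)).
      * apply filter_le_within.
      * apply (ex_derive_continuous (fun t => -2 * C * exp (- (t / 2)))). auto_derive; auto.
    + apply (filterlim_comp _ _ _ (fun t => exp (- (t / 2))) (fun y => -2 * C * y) _ (locally 0)).
      * apply is_lim_exp_opp_half.
      * apply (ex_derive_continuous (fun y => -2 * C * y) 0). auto_derive; auto.
Qed.

Lemma is_RInt_gen_Gamma (s : R) : 1 <= s ->
  is_RInt_gen (gamma_density s) (at_right 0) (Rbar_locally p_infty) (Gamma s).
Proof.
  intros Hs. apply (RInt_gen_correct (gamma_density s)).
  now apply ex_RInt_gen_gamma_density.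
Qed.

Lemma Gamma_pos (s : R) : 1 <= s -> 0 < Gamma s.
Proof.
  intros Hs.
  apply Rlt_le_trans with (RInt (gamma_density s) 1 2).
  - apply RInt_gt_0; [lra|intros; apply gamma_density_pos|].
    intros x Hx. apply continuous_gamma_density; lra.
  - apply (RInt_le_RInt_gen (at_right 0) (fun a => 0 < a)); try lra.
    + apply at_right_proper_filter.
    + apply lower_bounds_at_right.
    + apply ex_RInt_gamma_density.
    + intros a x _ _. left; apply gamma_density_pos.
    + now apply is_RInt_gen_Gamma.
Qed.

(** Integration by parts: [gamma_density (s + 1)] is [t ^ s * exp (- t)], it tends to [0] at both
    ends, and its derivative is [s * gamma_density s - gamma_density (s + 1)]. *)
Lemma Gamma_succ (s : R) : 1 <= s -> Gamma (s + 1) = s * Gamma s.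
Proof.
  intros Hs.
  assert (Hlim : is_RInt_gen (fun t => s * gamma_density s t - gamma_density (s + 1) t)
                   (at_right 0) (Rbar_locally p_infty) (0 - 0)).
  { apply (is_RInt_gen_primitive _ _ (gamma_density (s + 1))); try apply filter_filter.
    - apply filter_prod_at_right_0. intros a b Ha Hb x Hx. simpl in Hx.
      rewrite Rmin_left in Hx by lra. split.
      + unfold gamma_density. replace (s + 1 - 1) with s by ring.
        replace (s * (Rpower x (s - 1) * exp (- x)) - Rpower x s * exp (- x))
          with (plus (mult (s * Rpower x (s - 1)) (exp (- x))) (mult (Rpower x s) (- exp (- x))))
          by (unfold plus, mult; simpl; ring).
        apply (is_derive_mult (fun t => Rpower t s) (fun t => exp (- t))).
        * apply is_derive_Rpower; lra.
        * auto_derive; auto; ring.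
        * intros; apply Rmult_comm.
      + apply (continuous_minus (fun t => s * gamma_density s t) (gamma_density (s + 1))).
        * apply (continuous_scal_r s (gamma_density s)), continuous_gamma_density; lra.
        * apply continuous_gamma_density; lra.
    (* For [0 < t < 1] and [s >= 1], [t ^ s * exp (- t) <= t]. *)
    - apply (filterlim_le_le (fun _ => 0) _ (fun t => t) (Finite 0)).
      + exists (mkposreal 1 Rlt_0_1). intros y Hy H0.
        unfold ball in Hy; simpl in Hy; unfold AbsRing_ball, abs, minus, plus, opp in Hy; simpl in Hy.
        apply Rabs_lt_between in Hy. split; [left; apply gamma_density_pos|].
        unfold gamma_density, Rpower. rewrite <- exp_plus.
        apply Rle_trans with (exp (ln y)); [|rewrite exp_ln by easy; apply Rle_refl]. apply exp_le_compat.
        assert (ln y <= 0). { rewrite <- ln_1. apply Rcomplements.ln_le; lra. }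
        nra.
      + apply filterlim_const.
      + apply (filterlim_filter_le_1 (fun t => t) (F := locally 0)).
        * apply filter_le_within.
        * apply filterlim_id.
    - destruct (gamma_density_le (s + 1)) as (C & HC & Hle); [lra|].
      apply (filterlim_le_le (fun _ => 0) _ (fun t => C * exp (- (t / 2))) (Finite 0)).
      + exists 0. intros x Hx. split; [left; apply gamma_density_pos|auto].
      + apply filterlim_const.
      + replace (Finite 0) with (Finite (C * 0)) by (f_equal; ring).
        apply (filterlim_comp _ _ _ (fun t => exp (- (t / 2))) (fun y => C * y) _ (locally 0)).
        * apply is_lim_exp_opp_half.
        * apply (ex_derive_continuous (fun y => C * y) 0). auto_derive; auto. }
  assert (Hdiff : is_RInt_gen (fun t => minus (scal s (gamma_density s t)) (gamma_density (s + 1) t))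
                   (at_right 0) (Rbar_locally p_infty) (minus (scal s (Gamma s)) (Gamma (s + 1)))).
  { apply (is_RInt_gen_minus (fun t => scal s (gamma_density s t)) (gamma_density (s + 1))).
    - apply (is_RInt_gen_scal (gamma_density s)). now apply is_RInt_gen_Gamma.
    - apply is_RInt_gen_Gamma; lra. }
  apply (is_RInt_gen_unique (V := R_CompleteNormedModule)) in Hlim. apply (is_RInt_gen_unique (V := R_CompleteNormedModule)) in Hdiff.
  unfold minus, scal, mult, plus, opp in Hdiff; simpl in Hdiff; unfold mult in Hdiff; simpl in Hdiff.
  unfold Rminus in Hlim. rewrite Hlim in Hdiff. lra.
Qed.

Lemma Gamma_1 : Gamma 1 = 1.
Proof.
  apply (is_RInt_gen_unique (gamma_density 1)).
  replace 1 with (0 - - exp (- 0)) at 2 by (rewrite Ropp_0, exp_0; ring).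
  apply (is_RInt_gen_ext (fun t => exp (- t))).
  - apply filter_prod_at_right_0. intros a b Ha Hb x Hx. simpl in Hx.
    rewrite Rmin_left in Hx by lra. unfold gamma_density.
    rewrite Rminus_diag, Rpower_O by lra. symmetry; apply Rmult_1_l.
  - apply (is_RInt_gen_primitive _ _ (fun t => - exp (- t))); try apply filter_filter.
    + apply filter_forall. intros ab x _. split; [auto_derive; auto; ring|].
      apply (ex_derive_continuous (fun t => exp (- t))). auto_derive; auto.
    + apply (filterlim_filter_le_1 (fun t => - exp (- t)) (F := locally 0)).
      * apply filter_le_within.
      * apply (ex_derive_continuous (fun t => - exp (- t))). auto_derive; auto.
    + replace 0 with (- 0) by ring.
      apply (filterlim_comp _ _ _ (fun t => exp (- t)) Ropp _ (locally 0)).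
      * apply (is_lim_comp exp Ropp p_infty 0 m_infty).
        -- apply is_lim_exp_m.
        -- apply (is_lim_opp (fun t => t) p_infty p_infty), is_lim_id.
        -- now exists 0.
      * apply (filterlim_opp 0).
Qed.

(** The Pochhammer symbol. It stands for a quotient of Gamma values even at arguments in [(0, 1)],
    such as [n / c - 3] may be, where the lemmas on [Gamma] above do not apply. *)
Fixpoint rising (x : R) (k : nat) : R :=
  match k with O => 1 | S k => rising x k * (x + INR k) end.

Lemma rising_pos (x : R) (k : nat) : 0 < x -> 0 < rising x k.
Proof.
  intros Hx. induction k as [|k IH]; [simpl; lra|].
  pose proof (pos_INR k). simpl. apply Rmult_lt_0_compat; lra.
Qed.

Lemma rising_S_l (x : R) (k : nat) : rising x (S k) = x * rising (x + 1) k.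
Proof.
  induction k as [|k IH]; [simpl; ring|].
  change (rising x (S (S k))) with (rising x (S k) * (x + INR (S k))).
  rewrite IH, S_INR. simpl. ring.
Qed.

Lemma Gamma_rising (s : R) (k : nat) : 1 <= s -> Gamma (s + INR k) = rising s k * Gamma s.
Proof.
  intros Hs. induction k as [|k IH].
  - simpl. rewrite Rplus_0_r. ring.
  - rewrite S_INR, <- Rplus_assoc. rewrite Gamma_succ, IH by (pose proof (pos_INR k); lra).
    simpl. ring.
Qed.

Lemma Gamma_fact (k : nat) : Gamma (INR (S k)) = INR (fact k).
Proof.
  induction k as [|k IH]; [exact Gamma_1|].
  rewrite S_INR, Gamma_succ, IH.
  - rewrite <- mult_INR. reflexivity.
  - rewrite S_INR. pose proof (pos_INR k); lra.
Qed.

(** * Moments of the Baskakov densities *)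

(** Unnormalised beta prime density in [c * t], with parameters [k + 1] and [m]. Here [m] measures
    the decay at infinity, and [m > 0] is the condition of integrability. *)
Definition beta_density (c m : R) (k : nat) (t : R) : R :=
  (c * t) ^ k / Rpower (1 + c * t) (m + INR k + 1).

(** For [k > 0] the subtracted quotient is the density of index [k - 1], so integration yields a
    two-term recursion in [k]. For [k = 0] the factor [INR k] removes the meaningless [pred 0]
    term. *)
Lemma is_derive_beta_primitive (c m : R) (k : nat) (t : R) : 0 < c -> 0 <= t ->
  is_derive (fun t => - ((c * t) ^ k / Rpower (1 + c * t) (m + INR k))) t
    (c * ((m + INR k) * beta_density c m k t - INR k * ((c * t) ^ pred k / Rpower (1 + c * t) (m + INR k)))).
Proof.
  intros Hc Ht. assert (Hu : 0 < 1 + c * t) by nra.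
  unfold beta_density, Rpower.
  assert (He : forall q, exp (q * ln (1 + c * t)) <> 0) by (intros; apply Rgt_not_eq, exp_pos).
  auto_derive; [split; [lra|split; [apply He|trivial]]|].
  replace ((m + INR k + 1) * ln (1 + c * t)) with ((m + INR k) * ln (1 + c * t) + ln (1 + c * t)) by ring.
  rewrite exp_plus, exp_ln by easy.
  specialize (He (m + INR k)). set (e := exp _) in *. field. split; lra.
Qed.

Lemma continuous_beta_density (c m : R) (k : nat) (t : R) : 0 < c -> 0 <= t ->
  continuous (beta_density c m k) t.
Proof.
  intros Hc Ht. assert (Hu : 0 < 1 + c * t) by nra.
  apply (ex_derive_continuous (beta_density c m k)). unfold beta_density, Rpower.
  auto_derive. repeat split; [lra|apply Rgt_not_eq, exp_pos].
Qed.

Lemma beta_density_nonneg (c m : R) (k : nat) (t : R) : 0 < c -> 0 <= t -> 0 <= beta_density c m k t.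
Proof.
  intros Hc Ht. apply Rmult_le_pos; [apply pow_le; nra|].
  left; apply Rinv_0_lt_compat, exp_pos.
Qed.

Lemma is_lim_beta_primitive (c m : R) (k : nat) : 0 < c -> 0 < m ->
  filterlim (fun t => - ((c * t) ^ k / Rpower (1 + c * t) (m + INR k)))
    (Rbar_locally p_infty) (locally 0).
Proof.
  intros Hc Hm.
  assert (Hlim : is_lim (fun t => Rpower (1 + c * t) (- m)) p_infty 0).
  { unfold Rpower. apply (is_lim_comp exp (fun t => - m * ln (1 + c * t)) p_infty 0 m_infty).
    - apply is_lim_exp_m.
    - replace m_infty with (Rbar_mult (- m) p_infty).
      + apply is_lim_scal_l.
        apply (is_lim_comp ln (fun t => 1 + c * t) p_infty p_infty p_infty).
        * apply is_lim_ln_p.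
        * apply (is_lim_plus (fun _ => 1) (fun t => c * t) p_infty 1 p_infty);
            [apply is_lim_const| |easy].
          replace p_infty with (Rbar_mult c p_infty) at 2; [apply is_lim_scal_l, is_lim_id|].
          simpl. case Rle_dec; intros H; [|exfalso; lra].
          case Rle_lt_or_eq_dec; intros H'; [easy|exfalso; lra].
        * now exists 0.
      + simpl. case Rle_dec; intros; [exfalso; lra|easy].
    - now exists 0. }
  (* [(c * t) ^ k <= (1 + c * t) ^ k] cancels the [k] in the exponent. *)
  apply (filterlim_le_le (fun t => - Rpower (1 + c * t) (- m)) _ (fun _ => 0) (Finite 0)).
  - exists 0. intros t Ht. assert (Hct : 0 < c * t) by nra.
    assert (Hp : 0 < Rpower (1 + c * t) (m + INR k)) by apply exp_pos.
    assert (Hq : 0 < Rpower (1 + c * t) m) by apply exp_pos.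
    split.
    + apply Ropp_le_contravar. apply (Rmult_le_reg_r (Rpower (1 + c * t) (m + INR k))); [easy|].
      unfold Rdiv. rewrite Rmult_assoc, Rinv_l, Rmult_1_r by lra.
      rewrite Rpower_plus, Rpower_Ropp, <- Rmult_assoc, Rinv_l, Rmult_1_l by lra.
      rewrite Rpower_pow by lra. apply pow_incr; lra.
    + assert (0 <= (c * t) ^ k / Rpower (1 + c * t) (m + INR k)); [|lra].
      apply Rmult_le_pos; [apply pow_le; lra|left; now apply Rinv_0_lt_compat].
  - apply (is_lim_opp _ p_infty 0) in Hlim. simpl in Hlim. rewrite Ropp_0 in Hlim. exact Hlim.
  - apply filterlim_const.
Qed.

Lemma filter_prod_at_point_0 (P : R * R -> Prop) :
  (forall b, 0 < b -> P (0, b)) ->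
  filter_prod (at_point 0) (Rbar_locally p_infty) P.
Proof.
  intros H. apply Filter_prod with (fun a => a = 0) (fun b => 0 < b).
  - reflexivity.
  - now exists 0.
  - intros a b -> Hb. auto.
Qed.

(** The value is the boundary term at [0]: it equals [1] for [k = 0], which starts the recursion,
    and vanishes afterwards. *)
Lemma is_RInt_gen_beta_derivative (c m : R) (k : nat) : 0 < c -> 0 < m ->
  is_RInt_gen (fun t =>
      c * ((m + INR k) * beta_density c m k t - INR k * ((c * t) ^ pred k / Rpower (1 + c * t) (m + INR k))))
    (at_point 0) (Rbar_locally p_infty) (0 ^ k).
Proof.
  intros Hc Hm.
  replace (0 ^ k) with (0 - - ((c * 0) ^ k / Rpower (1 + c * 0) (m + INR k))).
  - apply (is_RInt_gen_primitive _ _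
      (fun t => - ((c * t) ^ k / Rpower (1 + c * t) (m + INR k)))); try apply filter_filter.
    + apply filter_prod_at_point_0. intros b Hb t Ht. simpl in Ht. rewrite Rmin_left in Ht by lra.
      split; [apply is_derive_beta_primitive; lra|].
      assert (Hu : 0 < 1 + c * t) by nra.
      match goal with |- continuous ?g _ => apply (ex_derive_continuous g) end.
      unfold beta_density, Rpower. auto_derive.
      repeat split; try lra; apply Rgt_not_eq, exp_pos.
    + intros P HP. exact (locally_singleton _ _ HP).
    + now apply is_lim_beta_primitive.
  - rewrite Rmult_0_r, Rplus_0_r. unfold Rpower. rewrite ln_1, Rmult_0_r, exp_0. field.
Qed.

(** The Beta integral [B (k + 1, m) / c], obtained by induction from the recursion in [k]. *)
Lemma is_RInt_gen_beta_density (c m : R) (k : nat) : 0 < c -> 0 < m ->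
  is_RInt_gen (beta_density c m k) (at_point 0) (Rbar_locally p_infty)
    (INR (fact k) / (c * rising m (S k))).
Proof.
  intros Hc Hm. induction k as [|k IH].
  - pose proof (is_RInt_gen_beta_derivative c m 0 Hc Hm) as H.
    apply (is_RInt_gen_Rmult_l _ _ _ (/ (c * m))) in H; try apply filter_filter.
    apply is_RInt_gen_eq with (5 := H); try apply filter_filter.
    + intros t. change (INR 0) with 0. rewrite Rmult_0_l, Rminus_0_r, Rplus_0_r. field. lra.
    + simpl. field. lra.
  - pose proof (is_RInt_gen_beta_derivative c m (S k) Hc Hm) as H.
    apply (is_RInt_gen_Rmult_l _ _ _ (INR (S k))) in IH; try apply filter_filter.
    apply (is_RInt_gen_Rmult_l _ _ _ (/ c)) in H; try apply filter_filter.
    pose proof (is_RInt_gen_Rplus _ _ _ _ _ _ _ _ H IH) as H'. clear H IH.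
    apply (is_RInt_gen_Rmult_l _ _ _ (/ (m + INR (S k)))) in H'; try apply filter_filter.
    pose proof (pos_INR (S k)) as Hk.
    pose proof (rising_pos m (S k) Hm) as Hr.
    apply is_RInt_gen_eq with (5 := H'); try apply filter_filter.
    + intros t. change (pred (S k)) with k. unfold beta_density at 2.
      replace (m + INR k + 1) with (m + INR (S k)) by (rewrite S_INR; ring).
      set (X := (c * t) ^ k / _). field. lra.
    + change (rising m (S (S k))) with (rising m (S k) * (m + INR (S k))).
      change (fact (S k)) with (S k * fact k)%nat. rewrite mult_INR.
      rewrite pow_i by lia. field. lra.
Qed.

(** A factor [t ^ j] leaves the power of [1 + c * t] unchanged, so it only raises [k] by [j] and
    lowers [m] by [j]. All moments thus come from one integral. *)
Lemma p_nvc_beta_density (n : nat) (c : R) (k j : nat) (t : R) : 0 < c -> 1 <= INR n / c ->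
  p_nvc n (S k) c t * t ^ j =
    c * rising (INR n / c) k / INR (fact k) / c ^ j
      * beta_density c (INR n / c - 1 - INR j) (k + j) t.
Proof.
  intros Hc HN. unfold p_nvc, beta_density.
  set (N := INR n / c) in *.
  replace (N + INR (S k) - 1) with (N + INR k) by (rewrite S_INR; ring).
  replace (N - 1 - INR j + INR (k + j) + 1) with (N + INR k) by (rewrite plus_INR; ring).
  rewrite Gamma_rising, Gamma_fact by easy.
  simpl (S k - 1)%nat. rewrite Nat.sub_0_r, pow_add, (Rpow_mult_distr c t j).
  pose proof (Gamma_pos N HN). pose proof (INR_fact_lt_0 k).
  assert (0 < c ^ j) by now apply pow_lt.
  assert (0 < Rpower (1 + c * t) (N + INR k)) by apply exp_pos.
  field. repeat split; lra.
Qed.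

Lemma p_nvc_nonneg (n : nat) (c : R) (k : nat) (t : R) : 0 < c -> 1 <= INR n / c -> 0 <= t ->
  0 <= p_nvc n (S k) c t.
Proof.
  intros Hc HN Ht. replace (p_nvc n (S k) c t) with (p_nvc n (S k) c t * t ^ 0) by apply Rmult_1_r.
  rewrite p_nvc_beta_density by easy.
  apply Rmult_le_pos; [|now apply beta_density_nonneg].
  pose proof (rising_pos (INR n / c) k ltac:(lra)). pose proof (INR_fact_lt_0 k). simpl.
  repeat apply Rmult_le_pos; try lra; left; apply Rinv_0_lt_compat; lra.
Qed.

Lemma continuous_p_nvc (n : nat) (c : R) (k : nat) (t : R) : 0 < c -> 1 <= INR n / c -> 0 <= t ->
  continuous (p_nvc n (S k) c) t.
Proof.
  intros Hc HN Ht.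
  apply continuous_ext with
    (fun t => scal (c * rising (INR n / c) k / INR (fact k) / c ^ 0)
                (beta_density c (INR n / c - 1 - INR 0) (k + 0) t)).
  - intros u. transitivity (p_nvc n (S k) c u * u ^ 0); [|apply Rmult_1_r].
    symmetry. now apply p_nvc_beta_density.
  - apply (continuous_scal_r _ (beta_density c (INR n / c - 1 - INR 0) (k + 0))).
    now apply continuous_beta_density.
Qed.

Lemma is_RInt_gen_p_nvc_moment (n : nat) (c : R) (k j : nat) : 0 < c -> 1 + INR j < INR n / c ->
  is_RInt_gen (fun t => p_nvc n (S k) c t * t ^ j) (at_point 0) (Rbar_locally p_infty)
    (c * rising (INR n / c) k / INR (fact k) / c ^ j
      * (INR (fact (k + j)) / (c * rising (INR n / c - 1 - INR j) (S (k + j))))).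
Proof.
  intros Hc HN. pose proof (pos_INR j).
  pose proof (is_RInt_gen_beta_density c (INR n / c - 1 - INR j) (k + j) Hc ltac:(lra)) as H0.
  apply (is_RInt_gen_Rmult_l _ _ _ (c * rising (INR n / c) k / INR (fact k) / c ^ j)) in H0;
    try apply filter_filter.
  apply is_RInt_gen_eq with (5 := H0); try apply filter_filter.
  - intros t. symmetry. apply p_nvc_beta_density; lra.
  - reflexivity.
Qed.

(** This is what the factor [(n - c) / c = n / c - 1] of the operator normalises. *)
Lemma is_RInt_gen_p_nvc_mass (n : nat) (c : R) (k : nat) : 0 < c -> 3 < INR n / c ->
  is_RInt_gen (p_nvc n (S k) c) (at_point 0) (Rbar_locally p_infty) (/ (INR n / c - 1)).
Proof.
  intros Hc HN.
  pose proof (is_RInt_gen_p_nvc_moment n c k 0 Hc ltac:(simpl; lra)) as H.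
  apply is_RInt_gen_eq with (5 := H); try apply filter_filter.
  - intros t. apply Rmult_1_r.
  - rewrite Nat.add_0_r, rising_S_l. simpl INR. rewrite Rminus_0_r.
    replace (INR n / c - 1 + 1) with (INR n / c) by ring. set (N := INR n / c) in *.
    pose proof (rising_pos N k ltac:(lra)). pose proof (INR_fact_lt_0 k).
    simpl. field. lra.
Qed.

(** Expectation of [(T - x) ^ 2] under the normalised density with [v = S k]: second moment, minus
    [2 * x] times the mean, plus [x ^ 2]. *)
Definition p_nvc_spread (N c x : R) (k : nat) : R :=
  INR (S k) * INR (S (S k)) / (c ^ 2 * ((N - 2) * (N - 3)))
    - 2 * x * (INR (S k) / (c * (N - 2))) + x ^ 2.

Lemma is_RInt_gen_p_nvc_spread (n : nat) (c x : R) (k : nat) : 0 < c -> 3 < INR n / c ->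
  is_RInt_gen (fun t => p_nvc n (S k) c t * (t - x) ^ 2) (at_point 0) (Rbar_locally p_infty)
    (p_nvc_spread (INR n / c) c x k / (INR n / c - 1)).
Proof.
  intros Hc HN.
  pose proof (is_RInt_gen_p_nvc_mass n c k Hc HN) as H0.
  pose proof (is_RInt_gen_p_nvc_moment n c k 1 Hc ltac:(simpl; lra)) as H1.
  pose proof (is_RInt_gen_p_nvc_moment n c k 2 Hc ltac:(simpl; lra)) as H2.
  apply (is_RInt_gen_Rmult_l _ _ _ (x ^ 2)) in H0; try apply filter_filter.
  apply (is_RInt_gen_Rmult_l _ _ _ (- (2 * x))) in H1; try apply filter_filter.
  pose proof (is_RInt_gen_Rplus _ _ _ _ _ _ _ _ H1 H0) as H.
  pose proof (is_RInt_gen_Rplus _ _ _ _ _ _ _ _ H2 H) as H'.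
  apply is_RInt_gen_eq with (5 := H'); try apply filter_filter.
  - intros t. ring.
  - clear H' H H0 H1 H2. unfold p_nvc_spread. set (N := INR n / c) in *.
    replace (k + 2)%nat with (S (S k)) by lia. replace (k + 1)%nat with (S k) by lia.
    rewrite !rising_S_l.
    replace (N - 1 - INR 2) with (N - 3) by (simpl; ring).
    replace (N - 1 - INR 1) with (N - 2) by (simpl; ring).
    replace (N - 3 + 1) with (N - 2) by ring.
    replace (N - 2 + 1) with (N - 1) by ring.
    replace (N - 1 + 1) with N by ring.
    change (fact (S (S k))) with (S (S k) * (S k * fact k))%nat.
    change (fact (S k)) with (S k * fact k)%nat. rewrite !mult_INR.
    pose proof (rising_pos N k ltac:(lra)). pose proof (INR_fact_lt_0 k).
    field. lra.
Qed.

(** * The error estimate *)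

Lemma p_nvc_spread_nonneg (n : nat) (c x : R) (k : nat) : 0 < c -> 3 < INR n / c ->
  0 <= p_nvc_spread (INR n / c) c x k.
Proof.
  intros Hc HN.
  assert (H : 0 <= p_nvc_spread (INR n / c) c x k / (INR n / c - 1)).
  { pose proof (is_RInt_gen_p_nvc_spread n c x k Hc HN) as H.
    assert (Hq : forall t, 0 <= t -> 0 <= p_nvc n (S k) c t * (t - x) ^ 2).
    { intros t Ht. apply Rmult_le_pos; [apply p_nvc_nonneg; lra|apply pow2_ge_0]. }
    (* Nonnegativity comes from the integrand: the zero integral over [[0, 0]] lies below the
       improper one. *)
    apply Rle_trans with (RInt (fun t => p_nvc n (S k) c t * (t - x) ^ 2) 0 0).
    - rewrite RInt_point. apply Rle_refl.
    - apply (RInt_le_RInt_gen (at_point 0) (fun a => a = 0)); auto; try lra.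
      + apply at_point_filter.
      + apply lower_bounds_at_point.
      + intros a b -> Hb. apply (ex_RInt_continuous (V := R_CompleteNormedModule)). intros z Hz.
        rewrite Rmin_left in Hz by lra.
        apply (continuous_mult (p_nvc n (S k) c) (fun t => (t - x) ^ 2)).
        * apply continuous_p_nvc; lra.
        * apply (ex_derive_continuous (fun t => (t - x) ^ 2)). auto_derive; auto.
      + intros a t -> Ht. now apply Hq. }
  set (N := INR n / c) in *. set (s := p_nvc_spread N c x k) in *.
  apply (Rmult_le_compat_r (N - 1)) in H; [|lra].
  replace (s / (N - 1) * (N - 1)) with s in H by (field; lra). lra.
Qed.

(** [f] is arbitrary on the negative reals, so at [0] its continuity is one-sided. Freezing it at
    [f 0] to the left gives the two-sided continuity that integrability on [[0, b]] is derived
    from. *)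
Lemma continuous_Rmax_0 (f : R -> R) (z : R) :
  (forall x, 0 <= x -> filterlim f (within (fun y => 0 <= y) (locally x)) (locally (f x))) ->
  0 <= z -> continuous (fun t => f (Rmax 0 t)) z.
Proof.
  intros Hf Hz. unfold continuous. rewrite (Rmax_right 0 z) by easy.
  apply filterlim_comp with (2 := Hf z Hz).
  intros P [eps HP]. exists eps. intros t Ht.
  apply HP; [|apply Rmax_l].
  unfold ball in *; simpl in *; unfold AbsRing_ball, abs, minus, plus, opp in *; simpl in *.
  apply Rabs_lt_between in Ht. apply Rabs_lt_between.
  destruct (Rle_dec 0 t) as [H|H]; [rewrite Rmax_right by lra|rewrite Rmax_left by lra];
    pose proof (cond_pos eps); lra.
Qed.

Lemma p_nvc_integral_bound (n : nat) (c x A W L : R) (k : nat) (f : R -> R) :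
  0 < c -> 3 < INR n / c ->
  (forall x, 0 <= x -> filterlim f (within (fun y => 0 <= y) (locally x)) (locally (f x))) ->
  (forall t, 0 <= t -> Rabs (f t - L) <= A * (t - x) ^ 2 + W) ->
  Rabs ((INR n / c - 1) *
          RInt_gen (fun t => p_nvc n (S k) c t * f t) (at_point 0) (Rbar_locally p_infty) - L)
    <= A * p_nvc_spread (INR n / c) c x k + W.
Proof.
  intros Hc HN Hf Hbd.
  set (N := INR n / c) in *. set (p := p_nvc n (S k) c).
  assert (Hp : forall t, 0 <= t -> 0 <= p t) by (intros; apply p_nvc_nonneg; fold N; lra).
  assert (Hpc : forall t, 0 <= t -> continuous p t) by (intros; apply continuous_p_nvc; fold N; lra).
  set (g t := p t * (f t - L)). set (h t := p t * (A * (t - x) ^ 2 + W)).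
  pose proof (is_RInt_gen_p_nvc_mass n c k Hc HN) as Hm.
  pose proof (is_RInt_gen_p_nvc_spread n c x k Hc HN) as Hs.
  fold N p in Hm, Hs.
  assert (Hh : is_RInt_gen h (at_point 0) (Rbar_locally p_infty)
                 ((A * p_nvc_spread N c x k + W) / (N - 1))).
  { pose proof (is_RInt_gen_Rmult_l _ _ _ A _ _ _ Hs) as H1.
    pose proof (is_RInt_gen_Rmult_l _ _ _ W _ _ _ Hm) as H2.
    pose proof (is_RInt_gen_Rplus _ _ _ _ _ _ _ _ H1 H2) as H.
    apply is_RInt_gen_eq with (5 := H); try apply filter_filter.
    - intros t. unfold h. ring.
    - field. lra. }
  assert (Hgh : forall t, 0 <= t -> Rabs (g t) <= h t).
  { intros t Ht. unfold g, h. rewrite Rabs_mult, (Rabs_pos_eq (p t)) by auto.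
    apply Rmult_le_compat_l; auto. }
  assert (Hg : ex_RInt_gen g (at_point 0) (Rbar_locally p_infty)).
  { apply (ex_RInt_gen_dominated (at_point 0) (fun a => a = 0) g h).
    - apply at_point_filter.
    - apply lower_bounds_at_point.
    - intros a b -> Hb. apply ex_RInt_ext with (fun t => p t * (f (Rmax 0 t) - L)).
      + intros t Ht. rewrite Rmin_left in Ht by lra. unfold g. now rewrite Rmax_right by lra.
      + apply (ex_RInt_continuous (V := R_CompleteNormedModule)). intros z Hz.
        rewrite Rmin_left in Hz by lra.
        apply (continuous_mult p (fun t => f (Rmax 0 t) - L)); [apply Hpc; lra|].
        apply (continuous_minus (fun t => f (Rmax 0 t)) (fun _ => L)).
        * apply continuous_Rmax_0; [easy|lra].
        * apply continuous_const.
    - intros a b -> Hb. apply (ex_RInt_continuous (V := R_CompleteNormedModule)). intros z Hz.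
      rewrite Rmin_left in Hz by lra.
      apply (continuous_mult p (fun t => A * (t - x) ^ 2 + W)); [apply Hpc; lra|].
      apply (ex_derive_continuous (fun t => A * (t - x) ^ 2 + W)). auto_derive; auto.
    - intros a t -> Ht. now apply Hgh.
    - eexists; exact Hh. }
  destruct Hg as [l Hl].
  assert (Hle : Rabs l <= (A * p_nvc_spread N c x k + W) / (N - 1)).
  { apply (RInt_gen_norm (V := R_CompleteNormedModule) (Fa := at_point 0) (Fb := Rbar_locally p_infty) g h);
      try easy.
    - apply filter_prod_at_point_0. intros b Hb. simpl; lra.
    - apply filter_prod_at_point_0. intros b Hb t Ht. simpl in Ht. apply Hgh; lra. }
  (* The integral of [p * f] is recovered from that of [p * (f - L)] by adding [L] times the
     mass. *)
  replace (RInt_gen (fun t => p t * f t) (at_point 0) (Rbar_locally p_infty)) with (l + L * / (N - 1)).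
  - replace ((N - 1) * (l + L * / (N - 1)) - L) with ((N - 1) * l) by (field; lra).
    rewrite Rabs_mult, (Rabs_pos_eq (N - 1)) by lra.
    apply (Rmult_le_compat_l (N - 1)) in Hle; [|lra].
    replace ((N - 1) * ((A * p_nvc_spread N c x k + W) / (N - 1)))
      with (A * p_nvc_spread N c x k + W) in Hle by (field; lra).
    exact Hle.
  - symmetry. apply (is_RInt_gen_unique (V := R_CompleteNormedModule)).
    pose proof (is_RInt_gen_Rplus _ _ _ _ _ _ _ _ Hl (is_RInt_gen_Rmult_l _ _ _ L _ _ _ Hm)) as H.
    apply is_RInt_gen_eq with (5 := H); try apply filter_filter; auto.
    intros t. unfold g. ring.
Qed.

Lemma ex_series_omega_spread (beta c N x y : R) : 0 <= beta < 1 -> 0 < c -> 3 < N -> 0 <= x -> 0 <= y ->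
  (forall k, 0 <= p_nvc_spread N c x k) ->
  ex_series (fun k => omega_beta beta (S k) y * p_nvc_spread N c x k).
Proof.
  intros Hb Hc HN Hx Hy Hs.
  destruct (jain_geometric_bound beta Hb) as (eps & r & Hr & Heps & _ & Hbd).
  (* The negative middle term of the spread is dropped, and [x ^ 2] is absorbed using
     [(k + 1) * (k + 2) >= 1]. *)
  set (B := / (c ^ 2 * ((N - 2) * (N - 3))) + x ^ 2).
  apply (ex_series_le (V := R_CompleteNormedModule) _
           (fun k => exp (eps * y) * B * (INR (S k) * INR (S (S k)) * r ^ k))).
  - intros k. change (norm ?z) with (Rabs z).
    pose proof (jain_nonneg beta (S k) y ltac:(lra) Hy) as H1. change (jain beta (S k) y)
      with (omega_beta beta (S k) y) in H1.
    pose proof (Hbd (S k) y Hy) as H2. change (jain beta (S k) y)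
      with (omega_beta beta (S k) y) in H2.
    rewrite Rabs_pos_eq by now apply Rmult_le_pos.
    assert (0 < r ^ k) by (apply pow_lt; lra).
    replace (exp (eps * y) * B * (INR (S k) * INR (S (S k)) * r ^ k))
      with (exp (eps * y) * r ^ k * (B * (INR (S k) * INR (S (S k))))) by ring.
    apply Rmult_le_compat; auto.
    + apply Rle_trans with (1 := H2). apply Rmult_le_compat_l; [left; apply exp_pos|]. simpl; nra.
    + assert (1 <= INR (S k)) by (rewrite S_INR; pose proof (pos_INR k); lra).
      assert (1 <= INR (S (S k))) by (rewrite S_INR; lra).
      assert (0 <= 2 * x * (INR (S k) / (c * (N - 2)))).
      { apply Rmult_le_pos; [lra|]. apply Rdiv_le_0_compat; [lra|apply Rmult_lt_0_compat; lra]. }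
      unfold p_nvc_spread, B. unfold Rdiv at 1.
      assert (x ^ 2 <= x ^ 2 * (INR (S k) * INR (S (S k)))).
      { pose proof (pow2_ge_0 x). assert (1 <= INR (S k) * INR (S (S k))) by nra. nra. }
      lra.
  - apply (ex_series_scal_l (V := R_NormedModule) (exp (eps * y) * B)). now apply ex_series_poly2_geom.
Qed.

(** The series carries mass [1 - E] and the atom at [0] mass [E = exp (- n x)]. The first
    contributes [W * (1 - E)], the second [E * (A * x ^ 2 + W)], and [E * x ^ 2] is the last summand
    of [mu2]. *)
Lemma D_op_estimate (n : nat) (c beta x A W : R) (f : R -> R) :
  0 < c -> 0 <= beta < 1 -> 3 < INR n / c -> 0 <= x ->
  (forall x, 0 <= x -> filterlim f (within (fun y => 0 <= y) (locally x)) (locally (f x))) ->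
  (forall t, 0 <= t -> Rabs (f t - f x) <= A * (t - x) ^ 2 + W) ->
  Rabs (D_op n c beta f x - f x) <= A * mu2 n c beta x + W.
Proof.
  intros Hc Hb HN Hx Hf Hbd.
  assert (Hy : 0 <= INR n * x) by (apply Rmult_le_pos; [apply pos_INR|easy]).
  pose proof (is_series_omega_beta beta (INR n * x) Hb Hy) as Hom.
  pose proof (fun k => p_nvc_integral_bound n c x A W (f x) k f Hc HN Hf Hbd) as Hint.
  pose proof (fun k => p_nvc_spread_nonneg n c x k Hc HN) as Hs.
  pose proof (ex_series_omega_spread beta c (INR n / c) x (INR n * x) Hb Hc HN Hx Hy Hs) as Hex.
  assert (Hw : forall k, 0 <= omega_beta beta (S k) (INR n * x))
    by (intros k; exact (jain_nonneg beta (S k) _ ltac:(lra) Hy)).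
  assert (HNc : (INR n - c) / c = INR n / c - 1) by (field; lra).
  set (N := INR n / c) in *. set (y := INR n * x) in *.
  set (w k := omega_beta beta (S k) y) in *.
  set (e k := RInt_gen (fun t => p_nvc n (S k) c t * f t) (at_point 0) (Rbar_locally p_infty)) in *.
  set (s k := p_nvc_spread N c x k) in *.
  set (d k := (N - 1) * e k - f x).
  set (E := exp (- y)) in *.
  assert (HE : 0 < E) by apply exp_pos.
  assert (Hmu : mu2 n c beta x = Series (fun k => w k * s k) + E * x ^ 2).
  { unfold mu2, D_op. fold y E. rewrite HNc. replace ((0 - x) ^ 2) with (x ^ 2) by ring.
    f_equal. rewrite <- Series_scal_l. apply Series_ext. intros k. cbv zeta. fold (w k).
    rewrite (is_RInt_gen_unique (V := R_CompleteNormedModule) _ _ (is_RInt_gen_p_nvc_spread n c x k Hc HN)).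
    fold N (s k). field. lra. }
  assert (Hws : is_series (fun k => w k * s k) (Series (fun k => w k * s k)))
    by now apply Series_correct.
  assert (Hup : is_series (fun k => w k * (A * s k + W))
                  (A * Series (fun k => w k * s k) + W * (1 - E))).
  { apply is_series_ext with (fun k => plus (scal A (w k * s k)) (scal W (w k))).
    - intros k. unfold plus, scal; simpl; unfold mult; simpl. ring.
    - apply (is_series_plus (V := R_NormedModule)); now apply (is_series_scal_l (V := R_NormedModule)). }
  assert (Hwd : forall k, Rabs (w k * d k) <= w k * (A * s k + W)).
  { intros k. rewrite Rabs_mult, (Rabs_pos_eq (w k)) by exact (Hw k).
    apply Rmult_le_compat_l; [exact (Hw k)|exact (Hint k)]. }
  assert (Hdabs : ex_series (fun k => Rabs (w k * d k))).
  { apply (ex_series_le (V := R_CompleteNormedModule) _ (fun k => w k * (A * s k + W))).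
    - intros k. change (norm ?z) with (Rabs z). rewrite Rabs_Rabsolu. apply Hwd.
    - eexists; exact Hup. }
  assert (Hd : Rabs (Series (fun k => w k * d k)) <= A * Series (fun k => w k * s k) + W * (1 - E)).
  { apply Rle_trans with (1 := Series_Rabs _ Hdabs).
    rewrite <- (is_series_unique _ _ Hup).
    apply Series_le; [|eexists; exact Hup].
    intros k. split; [apply Rabs_pos|apply Hwd]. }
  assert (HD : D_op n c beta f x - f x = Series (fun k => w k * d k) + E * (f 0 - f x)).
  { unfold D_op. fold y E. rewrite HNc, <- Series_scal_l.
    match goal with |- Series ?u + _ - _ = _ =>
      replace (Series u) with (Series (fun k => w k * d k) + f x * (1 - E)) end; [ring|].
    symmetry. apply is_series_unique.
    apply is_series_ext with (fun k => plus (w k * d k) (scal (f x) (w k))).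
    - intros k. cbv zeta. fold (w k) (e k). unfold d, plus, scal; simpl; unfold mult; simpl. ring.
    - apply (is_series_plus (V := R_NormedModule)); [|now apply (is_series_scal_l (V := R_NormedModule))].
      apply Series_correct. now apply ex_series_Rabs. }
  rewrite HD, Hmu.
  apply Rle_trans with (1 := Rabs_triang _ _). rewrite Rabs_mult, (Rabs_pos_eq E) by lra.
  specialize (Hbd 0 ltac:(lra)). replace ((0 - x) ^ 2) with (x ^ 2) in Hbd by ring.
  apply (Rmult_le_compat_l E) in Hbd; [|lra]. lra.
Qed.

(** The atom at [0] alone contributes [exp (- n x) * x ^ 2 > 0]. This makes [sqrt mu2] an admissible
    [delta]. *)
Lemma mu2_pos (n : nat) (c beta x : R) : 0 < c -> 0 <= beta < 1 -> 3 < INR n / c -> 0 < x ->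
  0 < mu2 n c beta x.
Proof.
  intros Hc Hb HN Hx.
  assert (HNc : (INR n - c) / c = INR n / c - 1) by (field; lra).
  unfold mu2, D_op. rewrite HNc, <- Series_scal_l.
  assert (0 < exp (- (INR n * x)) * (0 - x) ^ 2).
  { apply Rmult_lt_0_compat; [apply exp_pos|]. nra. }
  match goal with |- 0 < Series ?u + _ => assert (0 <= Series u) end; [|lra].
  assert (Hy : 0 <= INR n * x) by (apply Rmult_le_pos; [apply pos_INR|lra]).
  assert (Hs : forall k, 0 <= p_nvc_spread (INR n / c) c x k) by (intros; now apply p_nvc_spread_nonneg).
  rewrite (Series_ext _ (fun k => omega_beta beta (S k) (INR n * x) * p_nvc_spread (INR n / c) c x k)).
  - replace 0 with (Series (fun _ : nat => 0 * 0)).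
    + apply Series_le; [|now apply ex_series_omega_spread; try lra].
      intros k. rewrite Rmult_0_l. split; [apply Rle_refl|].
      apply Rmult_le_pos; [|apply Hs]. exact (jain_nonneg beta (S k) _ ltac:(lra) Hy).
    + rewrite Series_scal_l. ring.
  - intros k. cbv zeta.
    rewrite (is_RInt_gen_unique (V := R_CompleteNormedModule) _ _ (is_RInt_gen_p_nvc_spread n c x k Hc HN)).
    set (N := INR n / c) in *. field. lra.
Qed.

(** * The modulus of continuity and the pointwise majorant *)

Lemma modcont_upper (a M delta : R) (f : R -> R) (x t : R) : 0 < a ->
  (forall z, 0 <= z -> Rabs (f z) <= M * (1 + z ^ 2)) ->
  0 <= x <= a + 1 -> 0 <= t <= a + 1 -> Rabs (t - x) <= delta ->
  Rabs (f t - f x) <= modcont a f delta.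
Proof.
  intros Ha HM Hx Ht Hd. unfold modcont.
  match goal with |- _ <= real (Lub_Rbar ?P) =>
    set (Q := P); destruct (Lub_Rbar_correct Q) as [Hub Hlub] end.
  assert (HQ : Q (Rabs (f t - f x))) by now exists x, t.
  assert (HM0 : 0 <= M).
  { pose proof (HM 0 ltac:(lra)). pose proof (Rabs_pos (f 0)). nra. }
  (* [real] sends infinite values to [0], so the supremum must be shown finite; the growth bound on
     [f] over [[0, a + 1]] does this. *)
  assert (Hfin : Rbar_le (Lub_Rbar Q) (2 * (M * (1 + (a + 1) ^ 2)))).
  { apply Hlub. intros v (x' & t' & Hx' & Ht' & _ & ->).
    assert (Hz : forall z, 0 <= z <= a + 1 -> Rabs (f z) <= M * (1 + (a + 1) ^ 2)).
    { intros z Hz. apply Rle_trans with (1 := HM z (proj1 Hz)).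
      apply Rmult_le_compat_l; [easy|]. apply Rplus_le_compat_l, pow_incr; lra. }
    pose proof (Hz x' Hx'). pose proof (Hz t' Ht').
    simpl. unfold Rminus. apply Rle_trans with (1 := Rabs_triang _ _). rewrite Rabs_Ropp. lra. }
  pose proof (Hub _ HQ) as H.
  destruct (Lub_Rbar Q) as [l| |]; simpl in *; easy.
Qed.

Lemma modcont_steps (a M delta : R) (f : R -> R) (m : nat) : 0 < a -> 0 < delta ->
  (forall z, 0 <= z -> Rabs (f z) <= M * (1 + z ^ 2)) ->
  forall x t, 0 <= x <= a + 1 -> 0 <= t <= a + 1 -> Rabs (t - x) <= INR m * delta ->
  Rabs (f t - f x) <= INR m * modcont a f delta.
Proof.
  intros Ha Hdelta HM. induction m as [|m IH]; intros x t Hx Ht Hd.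
  - simpl in *. rewrite Rmult_0_l in *. pose proof (Rabs_pos (t - x)).
    replace t with x.
    + rewrite Rminus_diag, Rabs_R0. lra.
    + symmetry. apply Rminus_diag_uniq, Rabs_eq_0; lra.
  - assert (exists z, 0 <= z <= a + 1 /\ Rabs (t - z) <= delta /\ Rabs (z - x) <= INR m * delta)
      as (z & Hz & H1 & H2).
    (* [z] lies one step [delta] from [t] towards [x], or is [x] itself if that is closer, so it
       never leaves [[0, a + 1]]. *)
    { rewrite S_INR in Hd. apply Rabs_le_between in Hd.
      assert (Hm : 0 <= INR m * delta) by (apply Rmult_le_pos; [apply pos_INR|lra]).
      destruct (Rle_dec (Rabs (t - x)) delta) as [H|H].
      - exists x. rewrite Rminus_diag, Rabs_R0. auto.
      - destruct (Rle_dec x t) as [Hxt|Hxt].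
        + rewrite Rabs_pos_eq in H by lra.
          exists (t - delta). split; [lra|]. split; apply Rabs_le; lra.
        + rewrite Rabs_left in H by lra.
          exists (t + delta). split; [lra|]. split; apply Rabs_le; lra. }
    pose proof (modcont_upper a M delta f z t Ha HM Hz Ht H1).
    pose proof (IH x z Hx Hz H2).
    replace (f t - f x) with ((f t - f z) + (f z - f x)) by ring.
    apply Rle_trans with (1 := Rabs_triang _ _). rewrite S_INR. lra.
Qed.

(** With [r = |t - x| / delta], one step is enough for [r <= 1]; for [r > 1] the number of steps
    [floor r + 1] is at most [1 + r <= 1 + r ^ 2]. *)
Lemma modcont_quadratic (a M delta : R) (f : R -> R) (x t : R) : 0 < a -> 0 < delta ->
  (forall z, 0 <= z -> Rabs (f z) <= M * (1 + z ^ 2)) ->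
  0 <= x <= a + 1 -> 0 <= t <= a + 1 ->
  Rabs (f t - f x) <= (1 + (t - x) ^ 2 / delta ^ 2) * modcont a f delta.
Proof.
  intros Ha Hdelta HM Hx Ht.
  assert (HW : 0 <= modcont a f delta).
  { pose proof (modcont_upper a M delta f x x Ha HM Hx Hx) as H.
    rewrite !Rminus_diag, Rabs_R0 in H. lra. }
  set (r := Rabs (t - x) / delta).
  assert (Hr : 0 <= r) by (apply Rdiv_le_0_compat; [apply Rabs_pos|easy]).
  assert (Hrd : Rabs (t - x) = r * delta) by (unfold r; field; lra).
  assert (Hsq : (t - x) ^ 2 / delta ^ 2 = r ^ 2).
  { rewrite <- pow2_abs, Hrd. field. lra. }
  rewrite Hsq.
  destruct (Rle_dec r 1) as [H1|H1].
  - apply Rle_trans with (1 * modcont a f delta).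
    + rewrite Rmult_1_l. apply (modcont_upper a M); auto. rewrite Hrd. nra.
    + apply Rmult_le_compat_r; [easy|]. pose proof (pow2_ge_0 r). lra.
  - destruct (nfloor_ex r Hr) as [m Hm].
    apply Rle_trans with (INR (S m) * modcont a f delta).
    + apply (modcont_steps a M); auto. rewrite Hrd, S_INR.
      apply Rmult_le_compat_r; lra.
    + apply Rmult_le_compat_r; [easy|]. rewrite S_INR. nra.
Qed.

(* For [t > a + 1] one has [t - x >= 1], hence [2 + x^2 + t^2 <= (4 + 3 a^2) (t - x)^2]. *)
Lemma increment_bound (a M delta : R) (f : R -> R) (x t : R) : 0 < a -> 0 < delta ->
  (forall z, 0 <= z -> Rabs (f z) <= M * (1 + z ^ 2)) ->
  0 <= x <= a -> 0 <= t ->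
  Rabs (f t - f x) <=
    (6 * M * (1 + a ^ 2) + modcont a f delta / delta ^ 2) * (t - x) ^ 2 + modcont a f delta.
Proof.
  intros Ha Hdelta HM Hx Ht.
  assert (HM0 : 0 <= M).
  { pose proof (HM 0 ltac:(lra)). pose proof (Rabs_pos (f 0)). nra. }
  assert (HW : 0 <= modcont a f delta).
  { pose proof (modcont_upper a M delta f x x Ha HM ltac:(lra) ltac:(lra)) as H.
    rewrite !Rminus_diag, Rabs_R0 in H. lra. }
  assert (Hd2 : 0 < / delta ^ 2) by (apply Rinv_0_lt_compat, pow_lt; easy).
  set (W := modcont a f delta) in *.
  assert (Hq : 0 <= (t - x) ^ 2) by apply pow2_ge_0.
  assert (HA : 0 <= M * (1 + a ^ 2)) by (pose proof (pow2_ge_0 a); nra).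
  destruct (Rle_dec t (a + 1)) as [H1|H1].
  - pose proof (modcont_quadratic a M delta f x t Ha Hdelta HM ltac:(lra) ltac:(lra)) as H.
    fold W in H. unfold Rdiv in *.
    assert (0 <= M * (1 + a ^ 2) * (t - x) ^ 2) by now apply Rmult_le_pos. lra.
  - assert (0 <= W / delta ^ 2 * (t - x) ^ 2).
    { apply Rmult_le_pos; [apply Rmult_le_pos; lra|easy]. }
    assert (Hb : 2 + x ^ 2 + t ^ 2 <= 6 * (1 + a ^ 2) * (t - x) ^ 2).
    { set (u := t - x). replace t with (x + u) by (unfold u; ring).
      assert (Hu : 1 <= u ^ 2) by (unfold u; nra).
      assert (Hxa : x ^ 2 <= a ^ 2) by (apply pow_incr; lra).
      assert (0 <= x ^ 2) by apply pow2_ge_0.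
      assert ((x + u) ^ 2 <= 2 * x ^ 2 + 2 * u ^ 2) by (pose proof (pow2_ge_0 (x - u)); lra).
      assert (x ^ 2 <= a ^ 2 * u ^ 2) by nra. nra. }
    apply (Rmult_le_compat_l M) in Hb; [|easy].
    pose proof (HM x ltac:(lra)). pose proof (HM t Ht).
    unfold Rminus at 1. apply Rle_trans with (1 := Rabs_triang _ _). rewrite Rabs_Ropp. lra.
Qed.

Theorem theorem2 (c beta a : R) (n : nat) (f : R -> R) (Mf : R) :
  0 < c -> 0 <= beta < 1 -> 0 < a -> INR n > 3 * c ->
  C_rho0 f ->
  (forall x, 0 <= x -> Rabs (f x) <= Mf * (1 + x ^ 2)) ->
  forall x, 0 <= x <= a ->
  Rabs (D_op n c beta f x - f x) <=
    6 * Mf * (1 + a ^ 2) * mu2 n c beta x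
    + 2 * modcont a f (sqrt (mu2 n c beta x)).
Proof.
  intros Hc Hb Ha Hn [Hf _] HM x Hx.
  assert (HN : 3 < INR n / c).
  { apply (Rmult_lt_reg_r c); [easy|]. unfold Rdiv. rewrite Rmult_assoc, Rinv_l by lra. lra. }
  destruct (Rle_lt_or_eq_dec 0 x (proj1 Hx)) as [Hx0|<-].
  - pose proof (mu2_pos n c beta x Hc Hb HN Hx0) as Hmu.
    set (mu := mu2 n c beta x) in *.
    assert (Hs : 0 < sqrt mu) by now apply sqrt_lt_R0.
    pose proof (D_op_estimate n c beta x _ _ f Hc Hb HN (proj1 Hx) Hf
      (fun t Ht => increment_bound a Mf (sqrt mu) f x t Ha Hs HM Hx Ht)) as H.
    fold mu in H. rewrite pow2_sqrt in H by lra.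
    (* Since [delta ^ 2 = mu], the quadratic part of the modulus term also contributes one whole
       modulus, hence the factor [2]. *)
    apply Rle_trans with (1 := H). apply Req_le. field. lra.
  (* At [x = 0] every Jain weight in the series has the factor [n * x = 0], so only the atom remains
     and the claim reduces to nonnegativity of the modulus at [0]. *)
  - assert (H0 : forall g, D_op n c beta g 0 = g 0).
    { intros g. unfold D_op. rewrite Rmult_0_r, Ropp_0, exp_0, Rmult_1_l.
      rewrite (Series_ext _ (fun _ => 0 * 0)).
      - rewrite Series_scal_l. ring.
      - intros k. cbv zeta. unfold omega_beta, Rdiv. ring. }
    unfold mu2. rewrite !H0, !Rminus_diag, Rabs_R0, pow_i, Rmult_0_r, sqrt_0 by lia.
    pose proof (modcont_upper a Mf 0 f 0 0 Ha HM ltac:(lra) ltac:(lra)) as H.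
    rewrite !Rminus_diag, Rabs_R0 in H. lra.
Qed.
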